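(* Let $d=d(n)$ be an integer-valued function of $n$ with $d(n)\ge 1$ for all $n$ and $d(n)=o(n^{1/3})$ as $n\to\infty$. Then there exists $N$ such that for all integers $n\ge N$, writing $d=d(n)$, for each graph $G\in\mathcal G_n(d)$ the following hold: (i) for each integer $k\ge 3$, $i_k(G)\le i_k(K_{d,n-d})$; (ii) if $G$ is not isomorphic to $K_{d,n-d}$, then $i_2(G)+i_4(G)<i_2(K_{d,n-d})+i_4(K_{d,n-d})$, and so $i(G)<i(K_{d,n-d})$.
   Context: Graphs are finite and simple. For integers $n$ and $d\ge 0$, $\mathcal G_n(d)$ denotes the set of graphs with $n$ vertices and minimum degree at least $d$. For a graph $G$ and integer $k\ge 0$, $i_k(G)$ is the number of independent sets of vertices of $G$ of size exactly $k$ (so $i_0(G)=1$), and $i(G)=\sum_{k\ge 0} i_k(G)$ is the total number of independent sets. $K_{d,n-d}$ is the complete bipartite graph with parts of sizes $d$ and $n-d$. *)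

(* Defs.v *)
From HB Require Import structures.
From mathcomp Require Import all_boot.

Set Implicit Arguments.
Unset Strict Implicit.
Unset Printing Implicit Defensive.

Record sgraph := SGraph {
  vertex :> finType;
  adj : rel vertex;
  adj_sym : symmetric adj;
  adj_irrefl : irreflexive adj }.

Section GraphNotions.
Variable G : sgraph.

Definition degree (v : G) : nat := #|[set w : G | adj v w]|.

(* Degrees are smaller than #|G|, so the default value #|G| of the iterated
   minimum only matters for the graph with no vertices. *)
Definition min_degree : nat := \big[minn/#|G|]_(v : G) degree v.

Definition independent (S : {set G}) : bool :=
  [forall v in S, forall w in S, ~~ adj v w].

Definition indep_num (k : nat) : nat :=
  #|[set S : {set G} | independent S & #|S| == k]|.

(* No set of vertices has more than #|G| elements, so the sum over all k is
   finite; see [indep_totalE]. *)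
Definition indep_total : nat := \sum_(k < #|G|.+1) indep_num k.

End GraphNotions.

Definition graph_class (n d : nat) (G : sgraph) : Prop :=
  #|G| = n /\ d <= min_degree G.

Definition isomorphic (G H : sgraph) : Prop :=
  exists2 f : G -> H, bijective f & forall u v : G, adj (f u) (f v) = adj u v.

Definition bipartite_adj (a b : nat) : rel ('I_a + 'I_b) :=
  fun u v => match u, v with
             | inl _, inr _ | inr _, inl _ => true
             | _, _ => false
             end.

Fact bipartite_adj_sym a b : symmetric (@bipartite_adj a b).
Proof. by move=> [i|i] [j|j]. Qed.

Fact bipartite_adj_irrefl a b : irreflexive (@bipartite_adj a b).
Proof. by case. Qed.

Definition complete_bipartite (a b : nat) : sgraph :=
  SGraph (@bipartite_adj_sym a b) (@bipartite_adj_irrefl a b).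

Lemma degree_lt_card (G : sgraph) (v : G) : degree v < #|G|.
Proof.
rewrite -cardsT; apply: proper_card; rewrite properEneq subsetT andbT.
by apply/eqP => /setP /(_ v); rewrite !inE adj_irrefl.
Qed.

Lemma leq_min_degree (G : sgraph) (d : nat) : 0 < #|G| ->
  (d <= min_degree G) = [forall v : G, d <= degree v].
Proof.
move=> G_gt0; rewrite /min_degree; set m := #|G|.
have E (s : seq G) : (d <= \big[minn/m]_(v <- s) degree v)
    = (d <= m) && all (fun v => d <= degree v) s.
  elim: s => [|x s IHs]; first by rewrite big_nil andbT.
  by rewrite big_cons leq_min IHs /= andbCA.
rewrite E; apply/andP/forallP => [[_ /allP h] v|h].
  by apply: h; rewrite mem_index_enum.
split; last by apply/allP => v _; exact: h.
by case/card_gt0P: G_gt0 => v _; apply: leq_trans (h v) (ltnW (degree_lt_card v)).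
Qed.

Lemma indep_totalE (G : sgraph) :
  indep_total G = #|[set S : {set G} | independent S]|.
Proof.
rewrite /indep_total -sum1dep_card.
rewrite (partition_big (fun S : {set G} => inord #|S| : 'I_#|G|.+1) predT) //=.
apply: eq_bigr => k _; rewrite /indep_num -sum1dep_card; apply: eq_bigl => S.
by rewrite -(inj_eq val_inj) /= inordK // ltnS max_card.
Qed.

(* Main.v *)
(** Deleting an edge whose two ends have degree larger than [d] keeps the minimum
    degree at least [d] and can only create independent sets, so we may assume
    that every edge of [G] meets a vertex of degree exactly [d].  The set [B] of
    vertices [v] with [degree v >= n - d] is then independent, hence has at most
    [d] elements, each of its vertices having at most [d] non-neighbours.

    By Goodman's identity [6 i_3 + 6 t + 3 \sum_v f (degree v) = n (n-1) (n-2)],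
    where [t] is the number of triangles and [f x = x (n - 1 - x)].  Outside [B]
    one has [f (degree v) >= f d]; a vertex [v] of [B] violates this, but then
    its neighbours have at least [d - 1] neighbours other than [v], and the ones
    inside [N(v)] produce triangles, so that
    [f (degree v) + 2 t_v >= f d - (n - 2 d)].  A triangle contains at most one
    vertex of [B], whence
    [6 i_3 <= n (n-1) (n-2) - 3 n f d + 3 #|B| (n - 2 d)].

    If [#|B| = d], then [G] is [K_(d,n-d)].  Otherwise the bound is smaller than
    [6 'C(n - d, 3)] by a multiple of [d ^ 3], because [n >= 64 d ^ 3]; as an
    independent [k]-set extends in at most [n - d - k] ways, the gain propagates
    to all [k >= 3], and for [k = 4] it exceeds the possible loss
    [i_2(G) - 'C(n - d, 2) <= d n / 2]. *)
Require Import Defs.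
From mathcomp Require Import all_boot zify.

Set Implicit Arguments.
Unset Strict Implicit.
Unset Printing Implicit Defensive.

(** * Counting independent sets by adding one vertex at a time *)

Section IndependentSets.
Variable G : sgraph.
Implicit Types (S : {set G}) (u v w : G).

Lemma adjC u v : adj u v = adj v u.
Proof. exact: adj_sym. Qed.

Lemma adj_neq u v : adj u v -> u != v.
Proof. by apply: contraTneq => ->; rewrite adj_irrefl. Qed.

Lemma independentP S :
  reflect {in S &, forall u v, ~~ adj u v} (independent S).
Proof.
apply: (iffP forall_inP) => h u; first by move=> v uS vS; exact: (forall_inP (h u uS)).
by move=> uS; apply/forall_inP => v vS; exact: h.
Qed.

Lemma independentS S S' : S' \subset S -> independent S -> independent S'.
Proof.
move=> /subsetP sS /independentP h; apply/independentP => u v uS vS.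
by apply: h; apply: sS.
Qed.

Lemma independent0 : independent (set0 : {set G}).
Proof. by apply/independentP => u v; rewrite inE. Qed.

Lemma independent1 u : independent [set u].
Proof.
by apply/independentP => x y; rewrite !inE => /eqP-> /eqP->; rewrite adj_irrefl.
Qed.

Lemma independentU1 v S :
  independent (v |: S) = independent S && [forall w in S, ~~ adj v w].
Proof.
apply/idP/andP => [h|[/independentP h /forall_inP h']].
  split; first exact: independentS (subsetUr _ _) h.
  by apply/forall_inP => w wS; apply: (independentP _ h); rewrite !inE ?eqxx ?wS ?orbT.
apply/independentP => x y; rewrite !inE => /predU1P[->|xS] /predU1P[->|yS].
- by rewrite adj_irrefl.
- exact: h'.
- by rewrite adjC h'.
- exact: h.
Qed.

Definition extensions S : {set G} := [set v | v \notin S & independent (v |: S)].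

(** Double counting of pairs formed by an independent [k.+1]-set and one of its vertices: removing
    the vertex leaves [S]. The weight [F] lets the count be iterated into sums over ordered pairs
    and triples. *)
Lemma sum_extensions (k : nat) (F : {set G} -> nat) :
  \sum_(S : {set G} | independent S && (#|S| == k))
     \sum_(v in extensions S) F (v |: S)
  = k.+1 * \sum_(S : {set G} | independent S && (#|S| == k.+1)) F S.
Proof.
transitivity (\sum_(S : {set G} | independent S && (#|S| == k.+1))
                \sum_(v in S) F S).
  rewrite !pair_big_dep /=.
  rewrite [RHS](reindex_onto (fun p => (p.2 |: p.1, p.2))
                             (fun p => (p.1 :\ p.2, p.2))) /=; last first.
    by case=> S v /= /andP[_ vS]; rewrite setD1K.
  apply: eq_bigl => -[S v] /=; rewrite !inE eqxx andbT.
  have [vS|vS] /= := boolP (v \in S).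
    rewrite !andbF; apply/esym/negbTE; rewrite negb_and orbC; apply/orP; left.
    by apply/eqP => -[E]; move: vS; rewrite -E !inE eqxx.
  rewrite setU1K // eqxx andbT cardsU1 vS add1n eqSS independentU1.
  by case: (independent S); rewrite //= andbC.
rewrite big_distrr; apply: eq_bigr => S /andP[_ /eqP <-].
by rewrite sum_nat_const.
Qed.

Lemma indep_numE k :
  indep_num G k = \sum_(S : {set G} | independent S && (#|S| == k)) 1.
Proof. by rewrite /indep_num -sum1dep_card. Qed.

(** As [0 < k], the set [S] has a vertex; its neighbours, at least [d] of them, lie outside [S] and
    cannot extend it, and neither can the [k] vertices of [S]. *)
Lemma indep_num_succ_le d k : (forall v, d <= degree v) -> 0 < k ->
  k.+1 * indep_num G k.+1 <= (#|G| - d - k) * indep_num G k.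
Proof.
move=> dG k_gt0; rewrite !indep_numE -(sum_extensions k (fun=> 1)) big_distrr /=.
apply: leq_sum => S /andP[iS /eqP cS]; rewrite muln1 sum1_card.
have [v vS] : exists v, v \in S by apply/set0Pn; rewrite -card_gt0 cS.
have sub : extensions S \subset ~: ([set w | adj v w] :|: S).
  apply/subsetP => w; rewrite !inE negb_or => /andP[wS]; rewrite wS andbT.
  by rewrite independentU1 adjC => /andP[_ /forall_inP ->].
apply: leq_trans (subset_leq_card sub) _.
rewrite cardsCs setCK cardsU.
have -> : [set w | adj v w] :&: S = set0.
  apply/setP => w; rewrite !inE; apply/negP => /andP[a wS].
  by move/independentP: iS => /(_ v w vS wS); rewrite a.
rewrite cards0 subn0 cS subnDA leq_sub2r // leq_sub2l //; exact: dG.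
Qed.

Lemma card_nonadj v : #|[set w | (w != v) && ~~ adj v w]| = #|G|.-1 - degree v.
Proof.
have -> : [set w | (w != v) && ~~ adj v w] = ~: (v |: [set w | adj v w]).
  by apply/setP => w; rewrite !inE negb_or.
by rewrite cardsCs setCK cardsU1 inE adj_irrefl /= /degree; lia.
Qed.

Lemma extensions_set1 u : extensions [set u] = [set v | (v != u) && ~~ adj u v].
Proof.
apply/setP => v; rewrite !inE independentU1 independent1 /=; congr (_ && _).
apply/forall_inP/idP => [h|h w]; first by rewrite adjC h ?inE.
by rewrite inE adjC => /eqP->.
Qed.

Lemma sum_indep1 (F : {set G} -> nat) :
  \sum_(S : {set G} | independent S && (#|S| == 1)) F S = \sum_(u : G) F [set u].
Proof.
rewrite -[LHS]mul1n -sum_extensions (big_pred1 set0) => [|S].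
  apply: eq_big => [u|u _]; last by rewrite setU0.
  by rewrite !inE setU0 independent1.
rewrite cards_eq0 andbC /=; case: eqP => //= ->; exact: independent0.
Qed.

Lemma sum_indep2 (F : {set G} -> nat) :
  2 * \sum_(S : {set G} | independent S && (#|S| == 2)) F S
  = \sum_(u : G) \sum_(v : G | (v != u) && ~~ adj u v) F [set v; u].
Proof.
rewrite -sum_extensions sum_indep1; apply: eq_bigr => u _.
by apply: eq_bigl => v; rewrite extensions_set1 inE.
Qed.

Lemma indep_num2E : 2 * indep_num G 2 = \sum_(v : G) (#|G|.-1 - degree v).
Proof.
rewrite indep_numE sum_indep2; apply: eq_bigr => u _.
by rewrite -card_nonadj -sum1dep_card.
Qed.

Lemma indep_num2_le d : (forall v, d <= degree v) ->
  2 * indep_num G 2 <= #|G| * (#|G|.-1 - d).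
Proof.
move=> dG; rewrite indep_num2E -sum_nat_const.
by apply: leq_sum => v _; rewrite leq_sub2l.
Qed.

(** * Ordered triples and Goodman's identity *)

Definition distinct3 u v w := [&& v != u, w != u & w != v].
Definition indep3 u v w :=
  [&& distinct3 u v w, ~~ adj u v, ~~ adj u w & ~~ adj v w].
Definition triangle u v w := [&& adj u v, adj u w & adj v w].
(** [v] and [w] differ automatically, as only [v] is adjacent to [u]; [w != u] is imposed because
    [u] is not adjacent to itself. *)
Definition cherry u v w := [&& adj u v, w != u & ~~ adj u w].

Lemma indep_num3E :
  6 * indep_num G 3 = \sum_(u : G) \sum_(v : G) \sum_(w : G) indep3 u v w.
Proof.
rewrite indep_numE (_ : 6 = 2 * 3) // -mulnA -sum_extensions sum_indep2.
apply: eq_bigr => u _; rewrite big_mkcond; apply: eq_bigr => v _ /=.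
case: ifP => [/andP[vu uv]|vuv]; last first.
  rewrite big1 // => w _; rewrite /indep3 /distinct3.
  by move: vuv; case: (v != u); case: (adj u v) => //= _; rewrite !andbF.
rewrite big_mkcond /=; apply: eq_bigr => w _.
rewrite inE !inE independentU1 negb_or /indep3 /distinct3 vu uv.
have -> : independent [set v; u].
  apply/independentP => x y; rewrite !inE => /orP[]/eqP-> /orP[]/eqP->;
    by rewrite ?adj_irrefl // adjC.
have -> : [forall x in [set v; u], ~~ adj w x] = ~~ adj u w && ~~ adj v w.
  apply/forall_inP/andP => [h|[h1 h2] x].
    by rewrite !(adjC _ w) !h // !inE eqxx ?orbT.
  by rewrite !inE => /orP[]/eqP->; rewrite adjC.
by case: (w != v); case: (w != u) => //=; case: (_ && _).
Qed.

Lemma distinct3E : \sum_(u : G) \sum_(v : G) \sum_(w : G) distinct3 u v w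
  = #|G| * (#|G|.-1 * #|G|.-2).
Proof.
rewrite -sum_nat_const; apply: eq_bigr => u _.
transitivity (\sum_(v in [set~ u]) #|G|.-2); last first.
  by rewrite sum_nat_const cardsC1.
rewrite [RHS]big_mkcond; apply: eq_bigr => v _; rewrite !inE /distinct3.
case: (boolP (v != u)) => vu /=; last by rewrite big1.
rewrite -big_mkcond sum1dep_card.
have -> : [set w | (w != u) && (w != v)] = ~: [set u; v].
  by apply/setP => w; rewrite !inE negb_or.
by rewrite cardsCs setCK cards2 eq_sym vu subn2.
Qed.

Lemma cherryE u : \sum_(v : G) \sum_(w : G) cherry u v w
  = degree u * (#|G|.-1 - degree u).
Proof.
rewrite -card_nonadj -sum_nat_const [RHS]big_mkcond; apply: eq_bigr => v _.
rewrite inE /cherry; case: (adj u v) => /=; last by rewrite big1.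
by rewrite -big_mkcond sum1dep_card.
Qed.

(* Each triple that is neither independent nor a triangle has exactly two
   vertices incident with both an edge and a non-edge of the triple. *)
Lemma goodman :
  6 * indep_num G 3 + \sum_(u : G) \sum_(v : G) \sum_(w : G) triangle u v w
   + 3 * \sum_(u : G) degree u * (#|G|.-1 - degree u)
  = #|G| * (#|G|.-1 * #|G|.-2).
Proof.
pose sum3 (f : G -> G -> G -> nat) := \sum_(u : G) \sum_(v : G) \sum_(w : G) f u v w.
have sum3D f g : sum3 (fun u v w => f u v w + g u v w) = sum3 f + sum3 g.
  rewrite /sum3 -big_split; apply: eq_bigr => u _.
  by rewrite -big_split; apply: eq_bigr => v _; rewrite -big_split.
have sw23 f : sum3 (fun u v w => f u w v) = sum3 f.
  by apply: eq_bigr => u _; rewrite exchange_big.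
have sw12 f : sum3 (fun u v w => f v u w) = sum3 f.
  by rewrite /sum3 exchange_big.
pose c u v w : nat := cherry u v w.
have cE : sum3 c = \sum_(u : G) degree u * (#|G|.-1 - degree u).
  by apply: eq_bigr => u _; rewrite -cherryE.
have c132 : sum3 (fun u v w => c u w v) = sum3 c by rewrite sw23.
have c213 : sum3 (fun u v w => c v u w) = sum3 c by rewrite (sw12 c).
have c231 : sum3 (fun u v w => c v w u) = sum3 c.
  by rewrite (sw12 (fun u v w => c u w v)).
have c312 : sum3 (fun u v w => c w u v) = sum3 c.
  by rewrite (sw23 (fun u v w => c v u w)).
have c321 : sum3 (fun u v w => c w v u) = sum3 c.
  by rewrite (sw23 (fun u v w => c v w u)).
pose i u v w : nat := indep3 u v w; pose t u v w : nat := triangle u v w.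
have : sum3 (fun u v w => distinct3 u v w + distinct3 u v w)
     = sum3 (fun u v w => i u v w + i u v w + (t u v w + t u v w)
              + (c u v w + c u w v + (c v u w + c v w u) + (c w u v + c w v u))).
  apply: eq_bigr => u _; apply: eq_bigr => v _; apply: eq_bigr => w _.
  rewrite /i /t /c /indep3 /triangle /cherry /distinct3.
  rewrite !(eq_sym u) !(eq_sym v) !(adjC v u) !(adjC w).
  have [->|_] := eqVneq v u.
    by rewrite adj_irrefl /=; case: (adj u w); case: (w == u).
  have [->|_] := eqVneq w u.
    by rewrite adj_irrefl !(adjC v u) /=; case: (adj u v); case: (u == v).
  have [->|_] := eqVneq w v.
    by rewrite adj_irrefl /=; case: (adj u v).
  by case: (adj u v); case: (adj u w); case: (adj v w).
rewrite !sum3D c132 c213 c231 c312 c321 cE /sum3 distinct3E -indep_num3E /t.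
lia.
Qed.

End IndependentSets.

(** * Vertices of large degree and the bound on independent triples *)

Section MinimumDegree.
Variables (G : sgraph) (d : nat).
Hypothesis degree_ge : forall v : G, d <= degree v.
Hypothesis card_ge : 2 * d < #|G|.

Definition big_vertices : {set G} := [set v | #|G| <= degree v + d].

(** A neighbour [v] of [u] has at least [d - 1] neighbours [w] other than [u]; each makes [u v w] a
    triangle if [w] is adjacent to [u], and a cherry otherwise. *)
Lemma cherry_triangle_ge (u : G) : degree u * d.-1 <=
  degree u * (#|G|.-1 - degree u) + \sum_(v : G) \sum_(w : G) triangle u v w.
Proof.
rewrite -cherryE -big_split -sum_nat_const [X in X <= _]big_mkcond /=.
apply: leq_sum => v _; rewrite inE; case: ifP => // uv; rewrite -big_split /=.
have : degree v <= \sum_(w : G) (cherry u v w + triangle u v w) + 1.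
  rewrite /degree (cardsD1 u) inE adjC uv addnC leq_add2r -sum1_card big_mkcond.
  apply: leq_sum => w _; rewrite !inE /cherry /triangle uv /=.
  by case: (w != u); case: (adj u w); case: (adj v w).
by have := degree_ge v; lia.
Qed.

Lemma big_vertex_local (v : G) : d * (#|G|.-1 - d) <=
  degree v * (#|G|.-1 - degree v)
  + (v \in big_vertices) * (\sum_(u : G) \sum_(w : G) triangle v u w)
  + (v \in big_vertices) * (#|G| - 2 * d).
Proof.
have := cherry_triangle_ge v; have := degree_ge v; have := card_ge.
have := degree_lt_card v; rewrite inE.
move: (#|G|) (degree v) (\sum_(u : G) _) => n x t xn dn dx h.
case: (leqP n (x + d)) => [nxd|xdn] /=; rewrite ?mul1n ?mul0n.
  (* For [d >= 1], [(n - d) * (d - 1) + (n - 2 * d) = d * (n - 1 - d)], whence the correction term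
     [n - 2 * d]. *)
  suff : d * (n.-1 - d) <= x * d.-1 + (n - 2 * d) by lia.
  have : (n - d) * d.-1 <= x * d.-1 by rewrite leq_mul2r leq_subLR addnC nxd orbT.
  have [->//|] := posnP d; case: d dn {dx h xn nxd} => // e dn _ /=.
  by have [m ->] : exists m, n = 2 * e.+1 + m.+1 by [exists (n - 2 * e.+1).-1; lia]; nia.
rewrite !addn0.
(* Here [d <= x <= n - 1 - d], and concavity reads [(d + a) * (d + b) = d * (d + a + b) + a * b]. *)
have [a xE] : exists a, x = d + a by exists (x - d); lia.
have [b nE] : exists b, n = (2 * d + a + b).+1 by exists (n.-1 - d - x); lia.
have -> : n.-1 - d = d + a + b by lia.
have -> : n.-1 - x = d + b by lia.
by rewrite xE; clear; nia.
Qed.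

Hypothesis edge_minimal : forall u v : G, adj u v -> (degree u <= d) || (degree v <= d).

Lemma big_vertex_degree (v : G) : v \in big_vertices -> d < degree v.
Proof. by rewrite inE; move: card_ge; lia. Qed.

Lemma big_vertices_nonadj (u v : G) :
  u \in big_vertices -> v \in big_vertices -> ~~ adj u v.
Proof.
move=> /big_vertex_degree du /big_vertex_degree dv.
by apply/negP => /edge_minimal; rewrite leqNgt du leqNgt dv.
Qed.

Lemma big_vertices_sub (v : G) : v \in big_vertices ->
  big_vertices \subset ~: [set w | adj v w].
Proof.
by move=> vB; apply/subsetP => u uB; rewrite !inE big_vertices_nonadj.
Qed.

Lemma card_nonneighbours (v : G) : v \in big_vertices -> #|~: [set w | adj v w]| <= d.
Proof.
by rewrite inE cardsCs setCK => h; rewrite leq_subLR; apply: h.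
Qed.

Lemma card_big_vertices : #|big_vertices| <= d.
Proof.
have [->|[v vB]] := set_0Vmem big_vertices; first by rewrite cards0.
exact: leq_trans (subset_leq_card (big_vertices_sub vB)) (card_nonneighbours vB).
Qed.

(** By symmetry the sum is the same whichever of the three positions is required to lie in [B], and
    an ordered triangle enters at most one of these sums because [B] is independent. *)
Lemma triangles_ge :
  3 * \sum_(v : G) (v \in big_vertices) * (\sum_(u : G) \sum_(w : G) triangle v u w)
  <= \sum_(u : G) \sum_(v : G) \sum_(w : G) triangle u v w.
Proof.
set B := big_vertices.
pose T1 := \sum_(u : G) \sum_(v : G) \sum_(w : G) (u \in B) * triangle u v w.
pose T2 := \sum_(u : G) \sum_(v : G) \sum_(w : G) (v \in B) * triangle u v w.
pose T3 := \sum_(u : G) \sum_(v : G) \sum_(w : G) (w \in B) * triangle u v w.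
have -> : \sum_(v : G) (v \in B) * (\sum_(u : G) \sum_(w : G) triangle v u w) = T1.
  apply: eq_bigr => u _; rewrite big_distrr; apply: eq_bigr => v _.
  by rewrite big_distrr.
have E2 : T2 = T1.
  rewrite /T2 exchange_big; apply: eq_bigr => v _; apply: eq_bigr => u _.
  apply: eq_bigr => w _; rewrite /triangle (adjC u v).
  by case: (adj v u); case: (adj u w); case: (adj v w).
have E3 : T3 = T2.
  apply: eq_bigr => u _; rewrite exchange_big; apply: eq_bigr => v _.
  apply: eq_bigr => w _; rewrite /triangle (adjC w v).
  by case: (adj u w); case: (adj u v); case: (adj v w).
have -> : 3 * T1 = T1 + T2 + T3 by rewrite E3 E2; lia.
rewrite -!big_split; apply: leq_sum => u _ /=.
rewrite -!big_split; apply: leq_sum => v _ /=.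
rewrite -!big_split; apply: leq_sum => w _ /=.
rewrite /triangle.
case: (boolP (adj u v)) => [uv|]; last by rewrite !muln0.
case: (boolP (adj u w)) => [uw|]; last by rewrite !muln0.
case: (boolP (adj v w)) => [vw|]; last by rewrite !muln0.
case: (boolP (u \in B)) => uB; case: (boolP (v \in B)) => vB;
  case: (boolP (w \in B)) => wB //.
- by case/negP: (big_vertices_nonadj uB vB).
- by case/negP: (big_vertices_nonadj uB vB).
- by case/negP: (big_vertices_nonadj uB wB).
- by case/negP: (big_vertices_nonadj vB wB).
Qed.

(** [big_vertex_local] is summed over all vertices; three times its triangle terms are covered by
    the triangle sum of [goodman]. *)
Lemma indep_num3_le : 6 * indep_num G 3 + 3 * (#|G| * (d * (#|G|.-1 - d)))
  <= #|G| * (#|G|.-1 * #|G|.-2) + 3 * (#|big_vertices| * (#|G| - 2 * d)).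
Proof.
rewrite -goodman.
have -> : #|big_vertices| * (#|G| - 2 * d)
    = \sum_(v : G) (v \in big_vertices) * (#|G| - 2 * d).
  by rewrite -big_distrl /= -sum1_card big_mkcond.
have : #|G| * (d * (#|G|.-1 - d)) <= \sum_(v : G) (degree v * (#|G|.-1 - degree v)
  + (v \in big_vertices) * (\sum_(u : G) \sum_(w : G) triangle v u w)
  + (v \in big_vertices) * (#|G| - 2 * d)).
  by rewrite -sum_nat_const; apply: leq_sum => v _; exact: big_vertex_local.
rewrite !big_split /=; have := triangles_ge.
move: (indep_num G 3) (#|G| * _) (\sum_(u : G) \sum_(v : G) _).
move: (\sum_(v : G) degree v * _) (\sum_(v : G) _ * (#|G| - _)) (\sum_(v : G) _ * _).
lia.
Qed.

(** A vertex of [B] has at most [d] non-neighbours, and [B] is among them, so its neighbourhood is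
    exactly [~: B]. A vertex outside [B] is then adjacent to all of [B], and edge-minimality caps
    its degree at [d]. *)
Lemma big_vertices_bipartite : 0 < d -> d <= #|big_vertices| ->
  forall u v : G, adj u v = (u \in big_vertices) (+) (v \in big_vertices).
Proof.
set B := big_vertices => d_gt0 dB.
have NB v : v \in B -> [set w | adj v w] = ~: B.
  move=> vB; apply: (canRL setCK); apply/esym/eqP.
  by rewrite eqEcard big_vertices_sub //= (leq_trans (card_nonneighbours vB)).
have adjB u v : u \in B -> adj u v = (v \notin B).
  by move=> /NB /setP/(_ v); rewrite !inE.
have NW w : w \notin B -> [set v | adj w v] = B.
  move=> wB; apply/esym/eqP; rewrite eqEcard; apply/andP; split.
    by apply/subsetP => v vB; rewrite inE adjC adjB.
  apply: (leq_trans _ dB); have [v vB] : exists v, v \in B.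
    by apply/set0Pn; rewrite -card_gt0 (leq_trans d_gt0).
  have : adj v w by rewrite adjB.
  by move/edge_minimal; rewrite leqNgt big_vertex_degree.
move=> u v; have [uB|uB] := boolP (u \in B); first exact: adjB.
by have /setP/(_ v) := NW _ uB; rewrite inE.
Qed.

End MinimumDegree.

(** * Comparison with the complete bipartite graph *)

Lemma isomorphic_complete_bipartite (G : sgraph) (B : {set G}) :
  (forall u v : G, adj u v = (u \in B) (+) (v \in B)) ->
  isomorphic G (complete_bipartite #|B| (#|G| - #|B|)).
Proof.
move=> adjE.
have EC : #|G| - #|B| = #|~: B| by rewrite [RHS]cardsCs setCK.
pose g (x : 'I_#|B| + 'I_(#|G| - #|B|)) : G :=
  match x with inl i => enum_val i | inr j => enum_val (cast_ord EC j) end.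
have gl i : g (inl i) \in B by exact: enum_valP.
have gr j : g (inr j) \notin B by have := enum_valP (cast_ord EC j); rewrite inE.
have g_inj : injective g.
  move=> [i|i] [j|j] E.
  - by congr inl; apply: enum_val_inj E.
  - by move: (gr j); rewrite -E gl.
  - by move: (gr i); rewrite E gl.
  - by congr inr; apply: (can_inj (cast_ordK EC)); apply: enum_val_inj E.
have [|f fK gK] := inj_card_bij g_inj.
  by rewrite card_sum !card_ord subnKC ?max_card.
exists f; first by exists g.
move=> u v; rewrite -{2}(gK u) -{2}(gK v) adjE.
by case: (f u) => i; case: (f v) => j; rewrite ?gl ?(negbTE (gr _)).
Qed.

Lemma indep_num_iso (G H : sgraph) k : isomorphic G H -> indep_num G k = indep_num H k.
Proof.
suff le (G1 G2 : sgraph) (f : G1 -> G2) : injective f ->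
    (forall u v, adj (f u) (f v) = adj u v) -> indep_num G1 k <= indep_num G2 k.
  case=> f [g fK gK] adjf; apply/eqP; rewrite eqn_leq.
  rewrite (le _ _ f (can_inj fK)) //= (le _ _ g (can_inj gK)) // => u v.
  by rewrite -adjf !gK.
move=> f_inj adjf; rewrite /indep_num -(card_imset _ (imset_inj f_inj)).
apply/subset_leq_card/subsetP => _ /imsetP[S + ->]; rewrite !inE.
rewrite card_imset // => /andP[/independentP iS ->]; rewrite andbT.
by apply/independentP => _ _ /imsetP[u uS ->] /imsetP[v vS ->]; rewrite adjf iS.
Qed.

(** The [k]-subsets of the side of size [b] are independent. A lower bound suffices, since this
    graph is always on the larger side of the comparison. *)
Lemma indep_num_complete_bipartite a b k :
  'C(b, k) <= indep_num (complete_bipartite a b) k.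
Proof.
rewrite -[b in 'C(b, k)]card_ord -card_draws.
pose f : 'I_b -> complete_bipartite a b := inr.
have f_inj : injective f by move=> i j [].
rewrite /indep_num -(card_imset _ (imset_inj f_inj)).
apply/subset_leq_card/subsetP => _ /imsetP[S + ->]; rewrite !inE card_imset // => ->.
by rewrite andbT; apply/independentP => _ _ /imsetP[u _ ->] /imsetP[v _ ->].
Qed.

(** * Deleting an edge *)

Section EdgeDeletion.
Variables (G : sgraph) (x y : G).

Definition deletion_adj : rel G :=
  fun u v => adj u v && ([set u; v] != [set x; y]).

Fact deletion_adj_sym : symmetric deletion_adj.
Proof. by move=> u v; rewrite /deletion_adj adjC setUC. Qed.

Fact deletion_adj_irrefl : irreflexive deletion_adj.
Proof. by move=> u; rewrite /deletion_adj adj_irrefl. Qed.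

Definition delete_edge : sgraph := SGraph deletion_adj_sym deletion_adj_irrefl.

Lemma delete_edge_sub k :
  [set S : {set G} | independent S & #|S| == k]
  \subset [set S : {set delete_edge} | independent S & #|S| == k].
Proof.
apply/subsetP => S; rewrite !inE => /andP[/independentP iS ->]; rewrite andbT.
by apply/independentP => u v uS vS; apply: contra (iS u v uS vS) => /andP[].
Qed.

Lemma indep_num_delete_edge k : indep_num G k <= indep_num delete_edge k.
Proof. exact: subset_leq_card (delete_edge_sub k). Qed.

(** The pair of ends becomes a new independent set. *)
Lemma indep_num2_delete_edge : adj x y -> indep_num G 2 < indep_num delete_edge 2.
Proof.
move=> xy; apply: proper_card; rewrite properE delete_edge_sub.
apply/subsetPn; exists [set x; y]; rewrite !inE cards2 (adj_neq xy) andbT.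
  apply/independentP => u v; rewrite !inE => /orP[]/eqP-> /orP[]/eqP->;
  by rewrite /= /deletion_adj ?adj_irrefl // ?(setUC [set y]) eqxx andbF.
by apply/negP => /independentP /(_ x y); rewrite !inE !eqxx orbT xy => /(_ isT isT).
Qed.

Lemma degree_delete_edge d (v : G) : d < degree x -> d < degree y ->
  d <= degree v -> d <= @degree delete_edge v.
Proof.
move=> dx dy dv; rewrite /degree /=.
(* Each end loses at most the other one; the form with [a] and [b] serves both ends. *)
have nbr (a b : G) : [set x; y] = [set a; b] ->
    degree a <= #|[set w : G | deletion_adj a w]|.+1.
  move=> E; rewrite /degree (cardsD1 b) -add1n leq_add ?leq_b1 //.
  apply/subset_leq_card/subsetP => w; rewrite !inE /deletion_adj => /andP[wb aw].
  rewrite aw E /=; apply: contra wb => /eqP/setP/(_ w); rewrite !inE eqxx orbT.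
  by move/esym/orP => [/eqP wa|//]; move: aw; rewrite wa adj_irrefl.
have [->|vx] := eqVneq v x; first by have := nbr x y erefl; lia.
have [->|vy] := eqVneq v y; first by have := nbr y x (setUC _ _); lia.
apply: leq_trans dv _; apply/subset_leq_card/subsetP => w; rewrite !inE /deletion_adj.
move=> ->; apply/eqP => /setP/(_ v); rewrite !inE eqxx /=.
by rewrite (negbTE vx) (negbTE vy).
Qed.

End EdgeDeletion.

(** * The numerical gap and the extremal statement for fixed [d] *)

Lemma leq_cube d : d <= d ^ 3.
Proof. by case: d => // d; rewrite -{1}(expn1 d.+1) leq_pexp2l. Qed.

(** For [b = d - 1] the bound on [6 * i] falls short of [6 * 'C(n - d, 3)] by
    [3 * n - d ^ 3 + 3 * d ^ 2 - 8 * d], which is at least [180 * d ^ 3] when [n >= 64 * d ^ 3]. *)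
Lemma bin3_gap n d b i : 0 < d -> 64 * d ^ 3 <= n -> b < d ->
  6 * i + 3 * (n * (d * (n.-1 - d))) <= n * (n.-1 * n.-2) + 3 * (b * (n - 2 * d)) ->
  i + 30 * d ^ 3 <= 'C(n - d, 3).
Proof.
case: d => // e _ h64 be h.
have h2 : 2 * e.+1 + 2 <= n by have := leq_cube e.+1; lia.
(* This substitution turns all truncated subtractions into polynomials. *)
have [m En] : exists m, n = 2 * e + 4 + m by exists (n - (2 * e + 4)); lia.
have := mul_bin_left (n - e.+1) 2; have := mul_bin_left (n - e.+1) 1.
rewrite bin1; move: ('C(n - e.+1, 3)) ('C(n - e.+1, 2)) => c3 c2.
have : b * (n - 2 * e.+1) <= e * (n - 2 * e.+1) by rewrite leq_mul2r; lia.
move: (b * _) h => bb; move: h64; rewrite !expnS expn0 muln1.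
have -> : n - 2 * e.+1 = m + 2 by lia.
have -> : n - e.+1 - 1 = e + m + 2 by lia.
have -> : n - e.+1 - 2 = e + m + 1 by lia.
have -> : n - e.+1 = e + m + 3 by lia.
have -> : n.-1 - e.+1 = e + m + 2 by lia.
have -> : n.-1 = (2 * e + m + 2).+1 by lia.
rewrite /= {}En; lia.
Qed.

Section SmallDegree.
Variables (d : nat).
Hypothesis d_gt0 : 0 < d.

Lemma edge_minimal_extremal (G : sgraph) : 64 * d ^ 3 <= #|G| ->
  (forall v : G, d <= degree v) ->
  (forall u v : G, adj u v -> (degree u <= d) || (degree v <= d)) ->
  isomorphic G (complete_bipartite d (#|G| - d)) \/
  indep_num G 3 + 30 * d ^ 3 <= 'C(#|G| - d, 3).
Proof.
move=> h64 dG emin.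
have h2 : 2 * d < #|G|.
  by have := leq_cube d; lia.
have [Bd|dB] := ltnP #|big_vertices G d| d.
  by right; apply: bin3_gap Bd _ => //; apply: indep_num3_le.
have cB : #|big_vertices G d| = d.
  by apply/eqP; rewrite eqn_leq dB card_big_vertices.
left; rewrite -{1 2}cB; apply: isomorphic_complete_bipartite.
exact: big_vertices_bipartite.
Qed.

(** Binomial coefficients satisfy with equality the recursion that [indep_num_succ_le] gives as an
    inequality, so the bound at size 3 propagates upwards. *)
Lemma indep_num_gap (G : sgraph) : 64 * d ^ 3 <= #|G| ->
  (forall v : G, d <= degree v) ->
  indep_num G 3 + 30 * d ^ 3 <= 'C(#|G| - d, 3) ->
  (forall k, 3 <= k -> indep_num G k <= 'C(#|G| - d, k)) /\
  indep_num G 2 + indep_num G 4 < 'C(#|G| - d, 2) + 'C(#|G| - d, 4).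
Proof.
move=> h64 dG gap; split=> [k|].
  elim: k => // k IHk; rewrite leq_eqVlt => /predU1P[<-|k3].
    exact: leq_trans (leq_addr _ _) gap.
  rewrite -(leq_pmul2l (ltn0Sn k)) mul_bin_left.
  apply: leq_trans (indep_num_succ_le dG _) _; first by lia.
  by rewrite leq_mul2l IHk ?orbT.
have := mul_bin_left (#|G| - d) 3; have := mul_bin_left (#|G| - d) 1.
rewrite bin1; have := indep_num2_le dG; have := indep_num_succ_le dG (ltn0Sn 2).
have := leq_cube d; move: h64 gap; move: (d ^ 3) => D.
move: #|G| ('C(_, 3)) ('C(_, 2)) ('C(_, 4)) => n c3 c2 c4.
move: (indep_num G 2) (indep_num G 3) (indep_num G 4) => i2 i3 i4.
move: d d_gt0 => [//|e] _ h64 gap dD h1 h2 h3 h4.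
have [m En] : exists m, n = 2 * e + 5 + m by exists (n - (2 * e + 5)); lia.
have E1 : n - e.+1 = e + m + 4 by lia.
have E2 : n.-1 - e.+1 = e + m + 3 by lia.
rewrite E1 E2 in h1 h2 h3 h4.
have {}h1 : 4 * i4 <= (e + m + 1) * i3 by apply: leq_trans h1 _; rewrite leq_mul2r; lia.
have {}h4 : 4 * c4 = (e + m + 1) * c3 by rewrite h4; congr (_ * _); lia.
have {}h3 : 2 * c2 = (e + m + 3) * (e + m + 4) by rewrite h3; congr (_ * _); lia.
(* With [d <= d ^ 3], the gain at size 4 is at least [30 * d * (n - d - 3) / 4], while the loss at
   size 2 is at most [d * (n - d - 1) / 2]. *)
have : (e + m + 1) * (i3 + 30 * e.+1) <= (e + m + 1) * c3.
  rewrite leq_mul2l; apply/orP; right; apply: leq_trans gap; rewrite leq_add2l.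
  by lia.
clear -h1 h2 h3 h4 En; nia.
Qed.

Lemma complete_bipartite_extremal (G : sgraph) : 64 * d ^ 3 <= #|G| ->
  (forall v : G, d <= degree v) ->
  let K := complete_bipartite d (#|G| - d) in
  (forall k, 3 <= k -> indep_num G k <= indep_num K k) /\
  (isomorphic G K \/
   indep_num G 2 + indep_num G 4 < indep_num K 2 + indep_num K 4).
Proof.
(* Edge deletion strictly increases [indep_num G 2], which [2 ^ #|G|] bounds crudely; this makes the
   induction terminate. *)
have [m] := ubnP (2 ^ #|G| - indep_num G 2).
elim: m G => // m IHm G; rewrite ltnS => hm h64 dG K.
case: (boolP [forall u : G, forall v : G, adj u v ==> (degree u <= d) || (degree v <= d)]).
  move=> /forallP emin.
  have {}emin (u v : G) : adj u v -> (degree u <= d) || (degree v <= d).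
    exact: implyP (forallP (emin u) v).
  have [iso|gap] := edge_minimal_extremal h64 dG emin.
    by split; [move=> k _; rewrite (indep_num_iso k iso) | left].
  have [le lt] := indep_num_gap h64 dG gap; split=> [k k3|].
    exact: leq_trans (le k k3) (indep_num_complete_bipartite _ _ _).
  right; apply: leq_trans lt _.
  by apply: leq_add; exact: indep_num_complete_bipartite.
move=> /forallPn[x /forallPn[y]]; rewrite negb_imply negb_or -!ltnNge.
case/and3P=> xy dx dy.
have lt2 := indep_num2_delete_edge xy.
have [|||le lt] := IHm (delete_edge x y).
- apply: leq_trans hm; rewrite ltn_sub2l //; apply: leq_trans lt2 _.
  rewrite -(cardsT G) -card_powerset; apply/subset_leq_card/subsetP => S _.
  by rewrite powersetE subsetT.
- exact: h64.
- by move=> v; apply: degree_delete_edge.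
split=> [k k3|]; first exact: leq_trans (indep_num_delete_edge x y k) (le k k3).
right; have lt24 : indep_num G 2 + indep_num G 4 <
    indep_num (delete_edge x y) 2 + indep_num (delete_edge x y) 4.
  by rewrite -addSn leq_add ?indep_num_delete_edge.
apply: leq_trans lt24 _.
(* If the smaller graph is already extremal, strictness comes from the deletion itself. *)
by case: lt => [iso|/ltnW//]; rewrite !(indep_num_iso _ iso).
Qed.

End SmallDegree.

(** * From single sizes to the total count *)

Lemma indep_num0 (G : sgraph) : indep_num G 0 = 1.
Proof.
rewrite indep_numE (big_pred1 set0) // => S /=.
by rewrite cards_eq0 andbC; case: eqP => //= ->; exact: independent0.
Qed.

Lemma indep_num1 (G : sgraph) : indep_num G 1 = #|G|.
Proof. by rewrite indep_numE sum_indep1 sum1_card. Qed.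

(** Sizes 0 and 1 contribute equally, sizes 2 and 4 are only comparable jointly and give strictness,
    and every other size is monotone. *)
Lemma indep_total_lt (G H : sgraph) : #|G| = #|H| -> 4 <= #|G| ->
  (forall k, 3 <= k -> indep_num G k <= indep_num H k) ->
  indep_num G 2 + indep_num G 4 < indep_num H 2 + indep_num H 4 ->
  indep_total G < indep_total H.
Proof.
move=> E G4 le lt; rewrite /indep_total -E.
pose i2 := @Ordinal #|G|.+1 2 (leq_trans (isT : 2 < 5) (G4 : 4 < #|G|.+1)).
pose i4 := @Ordinal #|G|.+1 4 G4.
rewrite (bigD1 i2) //= (bigD1 i4) //= [X in _ < X](bigD1 i2) //=.
rewrite [X in _ < _ + X](bigD1 i4) //= !addnA -addSn leq_add //.
apply: leq_sum => -[[|[|[|k]]] kP] // _ /=; rewrite ?indep_num0 ?indep_num1 ?E //.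
exact: le.
Qed.

(* Imported only here because [classical_sets] shadows the [finset] lemmas. *)
From mathcomp Require Import all_order all_algebra.
From mathcomp Require Import all_classical all_reals all_analysis.
Import Order.TTheory GRing.Theory Num.Theory.
Import numFieldNormedType.Exports.
Local Open Scope classical_set_scope.

(** * The growth condition on [d] and the conclusion *)

Lemma cube_le_of_littleo (R : realType) (d : nat -> nat) :
  ((fun n : nat => (d n)%:R : R) =o_\oo
     (fun n : nat => n%:R `^ (3%:R^-1) : R))%R ->
  exists N : nat, forall n : nat, N <= n -> 64 * d n ^ 3 <= n.
Proof.
(* The constant 1/4 is chosen so that cubing [4 * d n <= n ^ (1/3)] yields the factor 64. *)
move/eqoP => /(_ (4%:R^-1)%R) []; first by rewrite invr_gt0 ltr0n.
move=> N _ hN; exists N => n /hN /=.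
rewrite ger0_norm ?ler0n // ger0_norm ?powR_ge0 // => h.
have {}h : ((4 * d n)%:R <= n%:R `^ (3%:R^-1) :> R)%R.
  by rewrite natrM -ler_pdivlMl ?ltr0n.
have := lerXn2r 3 _ _ h; rewrite !nnegrE ler0n powR_ge0 => /(_ isT isT).
rewrite -(powR_mulrn 3 (powR_ge0 _ _)) -powRrM mulVf ?pnatr_eq0 // powRr1 ?ler0n //.
by rewrite -natrX ler_nat expnMn.
Qed.

Theorem theorem1 (R : realType) (d : nat -> nat)
    (d_ge1 : forall n : nat, (1 <= d n)%N)
    (d_o : ((fun n : nat => (d n)%:R : R) =o_\oo
            (fun n : nat => n%:R `^ (3%:R^-1) : R))%R) :
  exists N : nat, forall n : nat, (N <= n)%N ->
  forall G : sgraph, graph_class n (d n) G ->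
    (forall k : nat, (3 <= k)%N ->
       (indep_num G k <= indep_num (complete_bipartite (d n) (n - d n)) k)%N)
    /\
    (~ isomorphic G (complete_bipartite (d n) (n - d n)) ->
       (indep_num G 2 + indep_num G 4 <
          indep_num (complete_bipartite (d n) (n - d n)) 2
          + indep_num (complete_bipartite (d n) (n - d n)) 4)%N
       /\
       (indep_total G <
          indep_total (complete_bipartite (d n) (n - d n)))%N).
Proof.
have [N hN] := cube_le_of_littleo d_o; exists N => n /hN h64 G [cG].
have d_gt0 := d_ge1 n.
(* Nonemptiness turns [min_degree] into a bound at every vertex, and [indep_total_lt] needs size 4
   to be in range. *)
have G4 : (4 <= #|G|)%N.
  by rewrite cG; apply: leq_trans h64; have := leq_cube (d n); lia.
rewrite leq_min_degree; last exact: leq_trans G4.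
move=> /forallP dG; have {}h64 : (64 * d n ^ 3 <= #|G|)%N by rewrite cG.
have dn : (d n <= n)%N by rewrite -[leqRHS]cG; have := leq_cube (d n); lia.
have := complete_bipartite_extremal d_gt0 h64 dG; rewrite cG => -[le lt].
split=> // not_iso; case: lt => [/not_iso //|lt]; split=> //.
apply: indep_total_lt => //.
by rewrite cG card_sum !card_ord subnKC.
Qed.
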